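(* Let $F$ be a finitely generated free group. Suppose $\kappa$ is an infinite cardinal such that $2^\kappa=\kappa^+$. Let $D$ be a non-principal ultrafilter on $\kappa$ and let $F^*=\prod_{i\in\kappa}F/D$ and $\mathbb Z^*=\prod_{i\in\kappa}\mathbb Z/D$ be the corresponding ultrapowers. Then $F^*\cong\widetilde F$ as groups, where $\widetilde F$ denotes the nonstandard model $F(\mathbb Z^* )$.
   Context: An absolute interpretation $\Gamma$ of an $L$-structure $\mathbb A$ in a structure $\mathbb B$ is a family of parameter-free formulas of the language of $\mathbb B$: $U_\Gamma(\bar x)$, $E_\Gamma(\bar x,\bar x')$ and $Q_\Gamma$ for each symbol $Q\in L$ (in $n$-tuples of variables), such that $E_\Gamma$ defines an equivalence relation on the set $U_\Gamma(\mathbb B)\subseteq B^n$, the $Q_\Gamma$ define (the preimages of the graphs of) constants, operations and relations on the quotient, and the resulting $L$-structure $\Gamma(\mathbb B)$ is isomorphic to $\mathbb A$. For $\widetilde{\mathbb B}\equiv\mathbb B$ the same formulas define an $L$-structure $\Gamma(\widetilde{\mathbb B})$. The free group $F$ on $x_1,\dots,x_k$ is absolutely interpreted in the ring $\mathbb Z$ as follows: a reduced word $x_{i_1}^{\varepsilon_1}\cdots x_{i_n}^{\varepsilon_n}$ corresponds to the finite tuple of integers $(\varepsilon_1 i_1,\dots,\varepsilon_n i_n)$ (the identity to the empty tuple), finite tuples of integers being coded by single numbers by means of a computable enumeration of finite tuples, which is arithmetically definable. Multiplication is concatenation of tuples followed by removal of the longest segment of the form $(d_\ell,\dots,d_1,-d_1,\dots,-d_\ell)$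 symmetric about the concatenation point. For $\widetilde{\mathbb Z}\equiv\mathbb Z$, the nonstandard model $F(\widetilde{\mathbb Z})$ is the group $\Gamma(\widetilde{\mathbb Z})$ defined in $\widetilde{\mathbb Z}$ by the formulas of this interpretation $\Gamma$. (Up to isomorphism it does not depend on the choice of the absolute interpretation $\Gamma$ of $F$ in $\mathbb Z$.) *)

(* Defs.v *)
From HB Require Import structures.
From mathcomp Require Import all_boot all_order all_algebra.
From mathcomp Require Import boolp classical_sets functions cardinality filter.

Set Implicit Arguments.
Unset Strict Implicit.
Unset Printing Implicit Defensive.

Local Open Scope classical_set_scope.
Local Open Scope quotient_scope.

(** * First-order logic *)

(** Constants are function symbols of arity 0. *)
Record language := Language {
  fsym : Type;
  farity : fsym -> nat;
  rsym : Type;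
  rarity : rsym -> nat }.

(** Formulas are indexed by the type [V] of their free variables, so a
    parameter-free formula in the variables [V] is an element of [formula K V].
    In [All p] the bound variable is [None]. *)
Inductive term (K : language) (V : Type) : Type :=
| Var of V
| App (s : fsym K) of 'I_(farity s) -> term K V.

Inductive formula (K : language) : Type -> Type :=
| Eq V : term K V -> term K V -> formula K V
| Rel V (r : rsym K) : ('I_(rarity r) -> term K V) -> formula K V
| Bot V : formula K V
| Imp V : formula K V -> formula K V -> formula K V
| All V : formula K (option V) -> formula K V.

Record structure (K : language) := Structure {
  carrier :> choiceType;
  fint : forall s : fsym K, ('I_(farity s) -> carrier) -> carrier;
  rint : forall r : rsym K, ('I_(rarity r) -> carrier) -> Prop }.

Fixpoint eval K (M : structure K) V (e : V -> M) (t : term K V) : M :=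
  match t with
  | Var v => e v
  | App s ts => fint (fun j => eval e (ts j))
  end.

Fixpoint holds K (M : structure K) V (p : formula K V) : (V -> M) -> Prop :=
  match p with
  | Eq _ t u => fun e => eval e t = eval e u
  | Rel _ r ts => fun e => rint (fun j => eval e (ts j))
  | Bot _ => fun _ => False
  | Imp _ q r => fun e => holds q e -> holds r e
  | All _ q => fun e => forall a : M, holds q (fun v => oapp e a v)
  end.

Definition isomorphic K (M N : structure K) : Prop :=
  exists f : M -> N,
    [/\ bijective f,
        forall (s : fsym K) (a : 'I_(farity s) -> M),
          f (fint a) = fint (f \o a)
      & forall (r : rsym K) (a : 'I_(rarity r) -> M),
          rint a <-> rint (f \o a)].

(** * Groups and rings as first-order structures *)

Inductive group_sym := GOne | GMul | GInv.

Definition group_arity (s : group_sym) : nat :=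
  match s with GOne => 0 | GMul => 2 | GInv => 1 end.

Definition group_language : language :=
  @Language group_sym group_arity void (fun r => match r with end).

Definition group_structure (G : groupType) : structure group_language :=
  @Structure group_language G
    (fun s => match s return ('I_(group_arity s) -> G) -> G with
       | GOne => fun _ => 1%g
       | GMul => fun a => (a ord0 * a ord_max)%g
       | GInv => fun a => (a ord0)^-1%g
       end)
    (fun r => match r with end).

Inductive ring_sym := RZero | ROne | RAdd | ROpp | RMul.

Definition ring_arity (s : ring_sym) : nat :=
  match s with RZero | ROne => 0 | RAdd | RMul => 2 | ROpp => 1 end.

Definition ring_language : language :=
  @Language ring_sym ring_arity void (fun r => match r with end).

Definition ring_structure (R : pzRingType) : structure ring_language :=
  @Structure ring_language R
    (fun s => match s return ('I_(ring_arity s) -> R) -> R with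
       | RZero => fun _ => 0%R
       | ROne => fun _ => 1%R
       | RAdd => fun a => (a ord0 + a ord_max)%R
       | ROpp => fun a => (- a ord0)%R
       | RMul => fun a => (a ord0 * a ord_max)%R
       end)
    (fun r => match r with end).

(** * Ultrapowers *)

Section Ultrapower.
Variables (I : Type) (D : set_system I) (UD : UltraFilter D).
Variables (K : language) (M : structure K).

Definition upow_rel : rel (I -> M) :=
  fun f g => `[< \forall i \near D, f i = g i >].

Lemma upow_rel_refl : reflexive upow_rel.
Proof. by move=> f; apply/asboolP; apply: nearW. Qed.

Lemma upow_rel_sym : symmetric upow_rel.
Proof.
by move=> f g; apply/asboolP/asboolP; apply: filterS => i ->.
Qed.

Lemma upow_rel_trans : transitive upow_rel.
Proof.
move=> g f h /asboolP fg /asboolP gh; apply/asboolP.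
by apply: filterS2 fg gh => i -> ->.
Qed.

Definition upow_equiv : equiv_rel (I -> M) :=
  EquivRel upow_rel upow_rel_refl upow_rel_sym upow_rel_trans.

Definition ultrapower : structure K :=
  @Structure K {eq_quot upow_equiv}
    (fun s a => \pi_{eq_quot upow_equiv} (fun i => fint (fun j => repr (a j) i)))
    (fun r a => \forall i \near D, rint (fun j => repr (a j) i)).

End Ultrapower.

(** * Absolute interpretations *)

(** An interpretation of [L]-structures in [K]-structures on [idim]-tuples.
    In [ieq], [inl i] and [inr i] are the [i]-th variables of the two tuples.
    In [ifun s], [inl i] is the [i]-th variable of the value tuple and
    [inr (j, i)] the [i]-th variable of the [j]-th argument tuple. *)
Record interpretation (L K : language) := Interpretation {
  idim : nat;
  idom : formula K 'I_idim;
  ieq : formula K ('I_idim + 'I_idim);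
  ifun : forall s : fsym L, formula K ('I_idim + 'I_(farity s) * 'I_idim);
  irel : forall r : rsym L, formula K ('I_(rarity r) * 'I_idim) }.

Section Interpretation.
Variables (L K : language) (Gam : interpretation L K) (B : structure K).

Definition point := {x : 'I_(idim Gam) -> B | `[< holds (idom Gam) x >]}.

Definition peq : rel point :=
  fun x y => `[< holds (ieq Gam)
                   (fun v => match v with inl i => val x i
                                        | inr i => val y i end) >].

Definition pfun (s : fsym L) (x : 'I_(farity s) -> point) (y : point) : Prop :=
  holds (ifun Gam s) (fun v => match v with inl i => val y i
                                          | inr (j, i) => val (x j) i end).

Definition prel (r : rsym L) (x : 'I_(rarity r) -> point) : Prop :=
  holds (irel Gam r) (fun v => val (x v.1) v.2).

(** The formulas of [Gam] define an [L]-structure in [B]: [pfun s] is the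
    preimage of the graph of an operation on the quotient of [point] by [peq],
    and [prel r] is the preimage of a relation on it. *)
Record defines_structure : Prop := DefinesStructure {
  ds_refl : reflexive peq;
  ds_sym : symmetric peq;
  ds_trans : transitive peq;
  ds_fun : forall (s : fsym L) (x : 'I_(farity s) -> point),
    exists y, forall x' y', (forall j, peq (x j) (x' j)) ->
      (pfun x' y' <-> peq y y');
  ds_rel : forall (r : rsym L) (x x' : 'I_(rarity r) -> point),
    (forall j, peq (x j) (x' j)) -> (prel x <-> prel x') }.

Hypothesis ds : defines_structure.

Definition peq_equiv : equiv_rel point :=
  EquivRel peq (ds_refl ds) (ds_sym ds) (ds_trans ds).

(** The structure [Gam(B)]. *)
Definition interpreted : structure L :=
  @Structure L {eq_quot peq_equiv}
    (fun s a => \pi_{eq_quot peq_equiv}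
       (projT1 (cid (ds_fun ds (fun j => repr (a j))))))
    (fun r a => prel (fun j => repr (a j))).

End Interpretation.

Definition absolute_interpretation L K (Gam : interpretation L K)
    (A : structure L) (B : structure K) : Prop :=
  exists ds : defines_structure Gam B, isomorphic (interpreted ds) A.

(** * Free groups *)

Definition free_basis (F : groupType) (k : nat) (x : 'I_k -> F) : Prop :=
  forall (G : groupType) (g : 'I_k -> G),
    exists2 f : {multiplicative F -> G}, (forall i, f (x i) = g i)
      & forall f' : {multiplicative F -> G}, (forall i, f' (x i) = g i) -> f' =1 f.

(** * Cardinals *)

Definition is_succ_card (I J : Type) : Prop :=
  [/\ ([set: I] #<= [set: J])%card, ~ ([set: J] #<= [set: I])%card
    & forall T : Type, ([set: I] #<= [set: T])%card ->
        ~ ([set: T] #<= [set: I])%card -> ([set: J] #<= [set: T])%card].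

(* Main.v *)
Require Import Defs.
From mathcomp Require Import all_boot all_order all_algebra.
From mathcomp Require Import boolp classical_sets functions cardinality filter.

Local Open Scope classical_set_scope.
Local Open Scope quotient_scope.

(** Interpretations commute with ultrapowers.  An interpretation of [A] in [B] amounts to a coordinate map
    from tuples of [B] onto [A] which turns the formulas of the interpretation
    into the atomic relations of [A].  Applying it componentwise to sequences
    gives a map from tuples of the ultrapower of [B] onto the ultrapower of
    [A], and by the theorem of Łoś it is again a coordinate map for the same
    formulas. *)

(** * The theorem of Łoś *)

Section Los.
Context {I : Type} {D : set_system I} (UD : UltraFilter D).

Lemma near_not (P : I -> Prop) :
  (~ \forall i \near D, P i) -> \forall i \near D, ~ P i.
Proof. by case: (in_ultra_setVsetC P UD). Qed.

Lemma near_iff (P Q : I -> Prop) : (\forall i \near D, P i <-> Q i) ->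
  (\forall i \near D, P i) <-> (\forall i \near D, Q i).
Proof. by move=> PQ; split; apply: filterS2 PQ => i []. Qed.

Lemma near_forall_ord n (P : 'I_n -> I -> Prop) :
  (forall j, \forall i \near D, P j i) -> \forall i \near D, forall j, P j i.
Proof. exact: filter_forall. Qed.

Context {K : language} {M : structure K}.

Notation "'[ f ]" := (\pi_{eq_quot (upow_equiv UD M)} f).

Lemma upow_eqP (f g : I -> M) :
  '[f] = '[g] <-> \forall i \near D, f i = g i.
Proof.
split=> [fg|fg]; first by apply/asboolP; move/eqmodP: fg.
by apply/eqmodP; apply/asboolP.
Qed.

Lemma upow_reprK (f : I -> M) :
  \forall i \near D, repr '[f] i = f i.
Proof. by apply/upow_eqP; rewrite reprK. Qed.

(** A representative of a class agrees with a given sequence only [D]-almost everywhere. Since a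
    function symbol has finitely many arguments, the exceptional sets of all of them can be
    discarded together. *)
Lemma eval_ultrapower V (e : V -> ultrapower UD M) (t : term K V) :
  eval e t = '[fun i => eval (fun v => repr (e v) i) t].
Proof.
elim: t => [v|s ts IH] /=; first by rewrite -[LHS]reprK.
apply/upow_eqP.
have : \forall i \near D, forall j,
    repr (eval e (ts j)) i = eval (fun v => repr (e v) i) (ts j).
  by apply: near_forall_ord => j; rewrite IH; apply: upow_reprK.
by apply: filterS => i /funext ->.
Qed.

Lemma los V (p : formula K V) (e : V -> ultrapower UD M) :
  holds p e <-> \forall i \near D, holds p (fun v => repr (e v) i).
Proof.
elim: p e => {V} [V t u|V r ts|V|V q IHq r IHr|V q IHq] e /=.
- by rewrite !eval_ultrapower upow_eqP.
- apply: near_iff.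
  have : \forall i \near D, forall j,
      repr (eval e (ts j)) i = eval (fun v => repr (e v) i) (ts j).
    by apply: near_forall_ord => j; rewrite eval_ultrapower; apply: upow_reprK.
  by apply: filterS => i /funext ->.
- by split=> // /filter_ex [].
- rewrite IHq IHr; split=> [qr|qr nq]; last by apply: filterS2 qr nq => i; apply.
  (* Maximality of [D]: either [q] holds almost everywhere, and then so does [r], or [q] fails
     almost everywhere and the implication is vacuous there. *)
  have [/qr|/near_not] :=
    pselect (\forall i \near D, holds q (fun v => repr (e v) i)).
    by apply: filterS => i.
  by apply: filterS.
- pose ext i (b : M) := fun v : option V => oapp (fun w => repr (e w) i) b v.
  have extE a i : (fun v => repr (oapp e a v) i) = ext i (repr a i).
    by apply/funext => -[].
  split=> [qe|qe a]; last first.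
    by apply/IHq; apply: filterS qe => i; rewrite extE; apply.
  apply: contrapT => /near_not nq.
  have {}nq : \forall i \near D, exists b, ~ holds q (ext i b).
    by apply: filterS nq => i /existsNP.
  have [_ [b0 _]] := filter_ex nq.
  (* The sequence [f] picks a counterexample to [q] wherever there is one; [b0] is a default value
     at the remaining indices. The class of [f] then contradicts [qe], as seen at a single index of
     a set in [D]. *)
  have /choice[f fP] : forall i, exists b,
      (exists b', ~ holds q (ext i b')) -> ~ holds q (ext i b).
    move=> i.
    have [[b nb]|nex] := pselect (exists b', ~ holds q (ext i b')).
      by exists b.
    by exists b0.
  have qf := proj1 (IHq _) (qe '[f]).
  have [i [[]]] := filter_ex (filterI (filterI nq (upow_reprK f)) qf).
  by move=> /fP nqi fi; rewrite extE fi.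
Qed.

End Los.

(** * Coordinate maps of interpretations *)

Record coordinate_map L K (Gam : interpretation L K) (B : structure K)
    (A : structure L) (h : ('I_(idim Gam) -> B) -> A) : Prop := CoordinateMap {
  cm_surj : forall a, exists2 x, holds (idom Gam) x & h x = a;
  cm_eq : forall x y, holds (idom Gam) x -> holds (idom Gam) y ->
    holds (ieq Gam) (fun v => match v with inl i => x i | inr i => y i end)
    <-> h x = h y;
  cm_fun : forall (s : Defs.fsym L) (x : 'I_(farity s) -> 'I_(idim Gam) -> B) y,
    (forall j, holds (idom Gam) (x j)) -> holds (idom Gam) y ->
    holds (ifun Gam s)
      (fun v => match v with inl i => y i | inr (j, i) => x j i end)
    <-> h y = fint (fun j => h (x j));
  cm_rel : forall (r : rsym L) (x : 'I_(rarity r) -> 'I_(idim Gam) -> B),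
    (forall j, holds (idom Gam) (x j)) ->
    holds (irel Gam r) (fun v => x v.1 v.2) <-> rint (fun j => h (x j)) }.

Arguments coordinate_map {L K} Gam {B A} h.
Arguments cm_surj {L K Gam B A h}.
Arguments cm_eq {L K Gam B A h} _ {x y}.
Arguments cm_fun {L K Gam B A h} _ {s x y}.
Arguments cm_rel {L K Gam B A h} _ {r x}.

Section CoordinateMap.
Context {L K : language} {Gam : interpretation L K}.
Context {B : structure K} {A : structure L}.

Lemma point_dom (p : Defs.point Gam B) : holds (idom Gam) (val p).
Proof. exact/asboolP/(valP p). Qed.

(** The map [h] is the projection of points to their classes followed by the given isomorphism. *)
Lemma absolute_interpretation_coordinate_map (a0 : A) :
  absolute_interpretation Gam A B ->
  exists h : ('I_(idim Gam) -> B) -> A, coordinate_map Gam h.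
Proof.
move=> [ds [g [[g' gK g'K] g_fun g_rel]]].
pose q (p : Defs.point Gam B) : interpreted ds := \pi_{eq_quot (peq_equiv ds)} p.
(* [h] is total on tuples; the value [a0] outside the domain is never examined by the clauses of
   [coordinate_map]. *)
pose h x := if insub x is Some p then g (q p) else a0.
have hE p : h (val p) = g (q p) by rewrite /h valK.
have lift x : holds (idom Gam) x -> {p : Defs.point Gam B | val p = x}.
  by move=> /asboolP dx; exists (exist _ x dx).
have lifts J (x : J -> 'I_(idim Gam) -> B) :
    (forall j, holds (idom Gam) (x j)) ->
    {p : J -> Defs.point Gam B | (fun j => val (p j)) = x}.
  move=> dx; exists (fun j => sval (lift _ (dx j))).
  by apply/funext => j; case: (lift _ _).
have qP p p' : peq p p' <-> q p = q p'.
  by split=> [pp'|/eqmodP //]; apply/eqmodP.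
have qK a : q (repr a) = a by rewrite /q reprK.
have reprq p : peq (repr (q p)) p by apply/qP; rewrite qK.
exists h; split.
- move=> a; exists (val (repr (g' a))); first exact: point_dom.
  by rewrite hE qK g'K.
- move=> x y /lift[p <-] /lift[p' <-]; rewrite !hE.
  have -> : (g (q p) = g (q p')) <-> (q p = q p').
    by split=> [/(can_inj gK)|->].
  by rewrite -qP; split=> /asboolP.
- move=> s x y /lifts[p <-] /lift[p' <-].
  have -> : (fun j => h (val (p j))) = g \o (q \o p).
    by apply/funext => j; rewrite hE.
  rewrite -g_fun hE.
  have -> : (g (q p') = g (fint (q \o p))) <-> (fint (q \o p) = q p').
    by split=> [/(can_inj gK)|->].
  rewrite /= -/(q _); case: cid => y' /= y'P; rewrite -/(q y') -qP.
  exact: y'P.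
- move=> r x /lifts[p <-].
  have -> : (fun j => h (val (p j))) = g \o (q \o p).
    by apply/funext => j; rewrite hE.
  (* The relation on the quotient is evaluated at chosen representatives, which are only equivalent
     to the points [p j]. *)
  rewrite -g_rel /=; apply: iff_sym; exact: (ds_rel ds).
Qed.

(** On points, [peq] is the kernel of [h], and [pfun] and [prel] are pullbacks along [h]. Invariance
    under [peq] is therefore automatic, and surjectivity of [h] identifies the quotient with [A]. *)
Lemma coordinate_map_interpreted (h : ('I_(idim Gam) -> B) -> A) :
  coordinate_map Gam h ->
  exists ds : defines_structure Gam B, isomorphic A (interpreted ds).
Proof.
move=> hP.
have peqP (p p' : Defs.point Gam B) : peq p p' <-> h (val p) = h (val p').
  rewrite -(cm_eq hP (point_dom p) (point_dom p')).
  by split=> /asboolP.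
have pfunP s (p : 'I_(farity s) -> Defs.point Gam B) p' :
    pfun p p' <-> h (val p') = fint (fun j => h (val (p j))).
  by apply: (cm_fun hP) => [j|]; apply: point_dom.
have prelP r (p : 'I_(rarity r) -> Defs.point Gam B) :
    prel p <-> rint (fun j => h (val (p j))).
  by apply: (cm_rel hP (x := fun j => val (p j))) => j; apply: point_dom.
have surj a : exists p : Defs.point Gam B, h (val p) = a.
  by have [x /asboolP dx <-] := cm_surj hP a; exists (exist _ x dx).
have ds : defines_structure Gam B.
  split.
  - by move=> p; apply/peqP.
  - by move=> p p'; apply/idP/idP => /peqP pp'; apply/peqP.
  - by move=> p' p p'' /peqP pp' /peqP p'p''; apply/peqP; rewrite pp'.
  - move=> s p; have [y hy] := surj (fint (fun j => h (val (p j)))).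
    exists y => p' y' pp'; rewrite pfunP peqP hy.
    suff -> : (fun j => h (val (p j))) = (fun j => h (val (p' j))) by split=> ->.
    by apply/funext => j; apply/peqP.
  - move=> r p p' pp'; rewrite !prelP.
    suff -> : (fun j => h (val (p j))) = (fun j => h (val (p' j))) by [].
    by apply/funext => j; apply/peqP.
exists ds.
(* [c] is a section of [h], and [q \o c] is the isomorphism; its inverse applies [h] to a
   representative. *)
have /choice[c cK] := surj.
pose q (p : Defs.point Gam B) : interpreted ds := \pi_{eq_quot (peq_equiv ds)} p.
have qP p p' : q p = q p' <-> h (val p) = h (val p').
  by rewrite -peqP; split=> [/eqmodP //|pp']; apply/eqmodP.
have valK_repr a : h (val (repr (q (c a)))) = a.
  by rewrite -[RHS]cK; apply/qP; rewrite /q reprK.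
exists (q \o c); split.
- exists (fun b => h (val (repr b))) => [a|b] /=; first exact: valK_repr.
  by rewrite -[RHS]reprK; apply/qP; rewrite cK.
- move=> s a /=; case: cid => y /= yP; apply/qP.
  rewrite cK.
  have /pfunP -> : pfun (fun j => repr ((q \o c) (a j))) y.
    by apply/yP => [j|]; apply/peqP.
  by congr fint; apply/funext => j /=; rewrite valK_repr.
- move=> r a /=; rewrite prelP.
  suff -> : (fun j => h (val (repr ((q \o c \o a) j)))) = a by [].
  by apply/funext => j /=; rewrite valK_repr.
Qed.

(** * Passage of coordinate maps to ultrapowers *)

Context {I : Type} {D : set_system I} (UD : UltraFilter D).

Definition ultrapower_map {J} (h : (J -> B) -> A)
    (x : J -> ultrapower UD B) : ultrapower UD A :=
  \pi_{eq_quot (upow_equiv UD A)} (fun i => h (fun v => repr (x v) i)).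

(** Łoś turns each formula in the ultrapower into its truth at almost every index, where the
    corresponding clause for [h] applies. Tuples and arities are finite, so almost-everywhere
    agreement holds for all coordinates and arguments at once. *)
Lemma coordinate_map_ultrapower (h : ('I_(idim Gam) -> B) -> A) :
  coordinate_map Gam h -> coordinate_map Gam (ultrapower_map h).
Proof.
move=> hP.
have near_dom n (x : 'I_n -> 'I_(idim Gam) -> ultrapower UD B) :
    (forall j, holds (idom Gam) (x j)) ->
    \forall i \near D, forall j, holds (idom Gam) (fun v => repr (x j v) i).
  by move=> dx; apply: near_forall_ord => j; apply/los.
have near_map n (x : 'I_n -> 'I_(idim Gam) -> ultrapower UD B) :
    \forall i \near D, (fun j => repr (ultrapower_map h (x j)) i) =
                       (fun j => h (fun v => repr (x j v) i)).
  have : \forall i \near D, forall j, repr (ultrapower_map h (x j)) i =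
                                      h (fun v => repr (x j v) i).
    by apply: near_forall_ord => j; apply: upow_reprK.
  by apply: filterS => i /funext.
split.
- move=> a.
  (* A preimage of [a] is built index by index from coordinates of the entries of a representative,
     then regrouped into a tuple [X] of classes. *)
  have /choice[x xP] : forall i, exists x, holds (idom Gam) x /\ h x = repr a i.
    by move=> i; have [x dx hx] := cm_surj hP (repr a i); exists x.
  pose X v : ultrapower UD B :=
    \pi_{eq_quot (upow_equiv UD B)} (fun i => x i v).
  have XE : \forall i \near D, (fun v => repr (X v) i) = x i.
    have : \forall i \near D, forall v, repr (X v) i = x i v.
      by apply: near_forall_ord => v; apply: upow_reprK.
    by apply: filterS => i /funext.
  exists X; first by apply/los; apply: filterS XE => i ->; case: (xP i).
  rewrite -[RHS]reprK; apply/upow_eqP.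
  by apply: filterS XE => i ->; case: (xP i).
- move=> x y /los dx /los dy; rewrite los upow_eqP; apply: near_iff.
  apply: filterS2 dx dy => i dx dy; rewrite -(cm_eq hP dx dy).
  (* Łoś takes representatives of the joined valuation, while [cm_eq] joins valuations of
     representatives. *)
  suff -> : (fun v => repr (match v with inl w => x w | inr w => y w end) i)
    = (fun v => match v with inl w => repr (x w) i | inr w => repr (y w) i end).
    by [].
  by apply/funext => -[].
- move=> s x y /near_dom dx /los dy; rewrite los upow_eqP; apply: near_iff.
  apply: filterS3 dx dy (near_map _ x) => i dx dy ->.
  rewrite -(cm_fun hP dx dy).
  suff -> : (fun v =>
        repr (match v with inl w => y w | inr (j, w) => x j w end) i)
    = (fun v =>
        match v with inl w => repr (y w) i | inr (j, w) => repr (x j w) i end).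
    by [].
  by apply/funext => -[w|[j w]].
- move=> r x /near_dom dx; rewrite los /=; apply: near_iff.
  by apply: filterS2 dx (near_map _ x) => i dx ->; rewrite -(cm_rel hP dx).
Qed.

End CoordinateMap.

Lemma interpretation_ultrapower {L K : language} {Gam : interpretation L K}
    {B : structure K} {A : structure L} (a0 : A)
    {I : Type} {D : set_system I} (UD : UltraFilter D) :
  absolute_interpretation Gam A B ->
  exists ds : defines_structure Gam (ultrapower UD B),
    isomorphic (ultrapower UD A) (interpreted ds).
Proof.
move=> /(absolute_interpretation_coordinate_map a0)[h hP].
exact/coordinate_map_interpreted/coordinate_map_ultrapower/hP.
Qed.

Theorem theorem4p2
  (k : nat) (F : groupType) (x : 'I_k -> F) (hx : free_basis x)
  (Gam : interpretation group_language ring_language)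
  (hGam : absolute_interpretation Gam (group_structure F) (ring_structure int))
  (kappa kappa_plus : Type)
  (hkappa : infinite_set [set: kappa])
  (hsucc : is_succ_card kappa kappa_plus)
  (hcard : ([set: kappa -> bool] #= [set: kappa_plus])%card)
  (D : set_system kappa) (UD : UltraFilter D)
  (hD : forall i : kappa, D <> principal_filter i) :
  exists ds : defines_structure Gam (ultrapower UD (ring_structure int)),
    isomorphic (ultrapower UD (group_structure F)) (interpreted ds).
(* The identity of [F] serves as the default value of the coordinate map outside the domain. *)
Proof. exact: (interpretation_ultrapower (1%g : group_structure F) UD hGam). Qed.
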